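(* Let $A$ be a symmetric (Hermitian) positive definite matrix, consider the linear system $Ax=y$ with exact solution $x_*=A^{-1}y$, let $t$ be an initial guess with error $c=x_*-t\neq 0$ and residual $z=y-At=Ac$. Let $\varepsilon\ge 0$ and let $\tilde z$ be an approximation of $z$ such that $$z=\tilde z+\delta z,\qquad (\tilde z,\delta z)=0,\qquad \|\delta z\|_A\le \varepsilon\|\tilde z\|_A\le \varepsilon\|z\|_A .$$ Let $x=t+\tilde z\,\dfrac{\|\tilde z\|^2}{\|\tilde z\|_A^2}$ be the result of the perturbed steepest descent step and $\tilde d=x_*-x$ its error. Then $$\|\tilde d\|_A\le \omega_{\tilde z}\,\|c\|_A,\qquad \omega_{\tilde z}=\omega_z+\varepsilon\sqrt{2(1-\omega_z^2)}+\frac{1}{2\sqrt2}\,\varepsilon^3\,\mathrm{cond}^2(A),$$ where $\omega_z\ge 0$ is the progress of the unperturbed steepest descent step, given by $$\omega_z^2=1-\frac{(z,z)}{(z,Az)}\,\frac{(z,z)}{(z,A^{-1}z)} .$$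
   Context: Vectors are finite-dimensional over $\mathbb R$ or $\mathbb C$; $u^*$ denotes the (conjugate) transpose. $(u,v)=u^*v$ is the standard scalar product with norm $\|u\|=(u,u)^{1/2}$. For a symmetric (Hermitian) positive definite $A$, $(u,v)_A=u^*Av$ and $\|u\|_A^2=(u,u)_A$. $\mathrm{cond}(A)=\lambda_{\max}(A)/\lambda_{\min}(A)$ is the ratio of the largest to the smallest eigenvalue of $A$. The unperturbed steepest descent step is $t\mapsto t+z\|z\|^2/\|z\|_A^2$; the square of the ratio of the $A$-norms of the errors after and before this step equals $\omega_z^2$. *)

(* Defs.v *)
From HB Require Import structures.
From mathcomp Require Import all_boot all_order all_algebra.
From mathcomp Require Import boolp classical_sets reals.
From mathcomp.real_closed Require Import complex.

Set Implicit Arguments.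
Unset Strict Implicit.
Unset Printing Implicit Defensive.
Import Order.TTheory GRing.Theory Num.Theory.
Local Open Scope ring_scope.
Local Open Scope classical_set_scope.

(* The scalar field is either R or C = R[i]; the next four definitions let both
   cases be treated at once. Norms, eigenvalues and eps always live in R. *)
Variant field_kind := RealField | ComplexField.

Definition base_field (R : realType) (k : field_kind) : numFieldType :=
  match k with RealField => R | ComplexField => R[i] end.

Definition conj_base (R : realType) (k : field_kind) :
    base_field R k -> base_field R k :=
  match k with RealField => id | ComplexField => @conjc R end.

Definition of_real (R : realType) (k : field_kind) : R -> base_field R k :=
  match k with RealField => id | ComplexField => real_complex R end.

Definition re_part (R : realType) (k : field_kind) : base_field R k -> R :=
  match k with RealField => id | ComplexField => @complex.Re R end.

Section Definitions.
Variables (R : realType) (k : field_kind) (n : nat).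
Local Notation K := (base_field R k).
Implicit Types (A : 'M[K]_n) (u v t z xs : 'cV[K]_n).

Definition ctrmx (m p : nat) (M : 'M[K]_(m, p)) : 'M[K]_(p, m) :=
  map_mx (@conj_base R k) M^T.

Definition dot u v : K := (ctrmx u *m v) 0 0.

Definition dotA A u v : K := (ctrmx u *m A *m v) 0 0.

(* re_part only changes the type: (u,u) and, for A positive definite, (u,u)_A
   are real. *)
Definition norm2 u : R := Num.sqrt (re_part (dot u u)).

Definition normA A u : R := Num.sqrt (re_part (dotA A u u)).

(* On R[i], 0 < w means that w is real and positive. *)
Definition posdef A : Prop :=
  ctrmx A = A /\ forall u, u != 0 -> 0 < dotA A u u.

(* Real eigenvalues; these are all the eigenvalues when A is Hermitian. *)
Definition spectrum A : set R := [set l | eigenvalue A (of_real k l)].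

(* The greatest and the least element of the spectrum. The default 0 is not
   used when A is Hermitian and n > 0. *)
Definition lambda_max A : R := xget 0 (spectrum A `&` ubound (spectrum A)).

Definition lambda_min A : R := xget 0 (spectrum A `&` lbound (spectrum A)).

Definition cond A : R := lambda_max A / lambda_min A.

Definition sd_step A t z : 'cV[K]_n :=
  t + of_real k (norm2 z ^+ 2 / normA A z ^+ 2) *: z.

(* Ratio of the A-norms of the errors after and before the steepest descent
   step from t along the residual of t, xs being the exact solution. *)
Definition sd_progress A xs t : R :=
  normA A (xs - sd_step A t (A *m xs - A *m t)) / normA A (xs - t).

End Definitions.

(* Main.v *)
From HB Require Import structures.
Require Import Defs.
From mathcomp Require Import all_boot all_order all_algebra.
From mathcomp Require Import boolp classical_sets reals.
From mathcomp.real_closed Require Import complex.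
From mathcomp Require Import ring lra.
Import Order.TTheory GRing.Theory Num.Theory.
Local Open Scope ring_scope.

(** Since [(zt, dz) = 0] and [z = A c], the coefficient of the perturbed step is
    [(zt, c)_A / (zt, zt)_A], so the step is an exact line search along [zt] and
    is at least as good as the step [a *: zt] with the unperturbed coefficient
    [a = ||z||^2 / ||z||_A^2].  As [c - a zt = (c - a z) + a dz], the triangle
    inequality bounds the error by [omega_z ||c||_A + a eps ||z||_A], and
    [a ||z||_A = sqrt (1 - omega_z^2) ||c||_A].  This is already stronger than
    the claim, without the factor [sqrt 2] and the cubic term. *)

(** * Conjugation, real embedding and real part over both scalar fields *)

Section Scalars.
Context {R : realType} {k : field_kind}.
Local Notation K := (base_field R k).

Lemma conj_base_is_zmod_morphism : zmod_morphism (@conj_base R k).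
Proof. by case: k => //= x y; rewrite rmorphB. Qed.

Lemma conj_base_is_monoid_morphism : monoid_morphism (@conj_base R k).
Proof.
case: k; first by split.
by split; [exact: rmorph1 (@conjc R) | exact: rmorphM (@conjc R)].
Qed.

HB.instance Definition _ := GRing.isZmodMorphism.Build K K (@conj_base R k)
  conj_base_is_zmod_morphism.
HB.instance Definition _ := GRing.isMonoidMorphism.Build K K (@conj_base R k)
  conj_base_is_monoid_morphism.

Lemma of_real_is_zmod_morphism : zmod_morphism (@of_real R k).
Proof. by case: k => //= x y; rewrite rmorphB. Qed.

Lemma of_real_is_monoid_morphism : monoid_morphism (@of_real R k).
Proof.
case: k; first by split.
by split; [exact: rmorph1 (real_complex R) | exact: rmorphM (real_complex R)].
Qed.

HB.instance Definition _ := GRing.isZmodMorphism.Build R K (@of_real R k)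
  of_real_is_zmod_morphism.
HB.instance Definition _ := GRing.isMonoidMorphism.Build R K (@of_real R k)
  of_real_is_monoid_morphism.

(** Only additivity can hold over [R[i]]; products with a real factor are handled by [re_partZ]. *)
Lemma re_part_is_zmod_morphism : zmod_morphism (@re_part R k).
Proof. by case: k => //= -[a b] [c d]. Qed.

HB.instance Definition _ := GRing.isZmodMorphism.Build K R (@re_part R k)
  re_part_is_zmod_morphism.

Lemma conj_baseK : involutive (@conj_base R k).
Proof. by case: k => //=; exact: conjcK. Qed.

Lemma conj_of_real (s : R) : conj_base (of_real k s) = of_real k s.
Proof. by case: k => //=; exact: conjc_real. Qed.

Lemma re_part_conj (w : K) : re_part (conj_base w) = re_part w.
Proof. by move: w; case: k => //= -[a b]. Qed.

Lemma re_partZ (s : R) (w : K) : re_part (of_real k s * w) = s * re_part w.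
Proof. by move: w; case: k => //= -[a b] /=; rewrite mul0r subr0. Qed.

Lemma re_part_ge0 (w : K) : 0 <= w -> 0 <= re_part w.
Proof. by move: w; case: k => //= -[a b]; rewrite lecE => /andP[]. Qed.

Lemma re_part_gt0 (w : K) : 0 < w -> 0 < re_part w.
Proof. by move: w; case: k => //= -[a b]; rewrite ltcE => /andP[]. Qed.

Lemma of_real_re_part (w : K) : 0 <= w -> of_real k (re_part w) = w.
Proof.
by move: w; case: k => //= -[a b]; rewrite lecE /= => /andP[/eqP -> _].
Qed.

Lemma mul_conj_ge0 (w : K) : 0 <= conj_base w * w.
Proof.
move: w; case: k => //= [w|w]; first by rewrite -expr2 sqr_ge0.
by rewrite mulrC; exact: mul_conjC_ge0.
Qed.

End Scalars.

(** * The scalar products and their real parts *)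

Section Forms.
Context {R : realType} {k : field_kind}.
Local Notation K := (base_field R k).

Lemma ctrmxM m n p (M : 'M[K]_(m, n)) (N : 'M[K]_(n, p)) :
  ctrmx (M *m N) = ctrmx N *m ctrmx M.
Proof. by rewrite /ctrmx trmx_mul map_mxM. Qed.

Lemma ctrmxK m n (M : 'M[K]_(m, n)) : ctrmx (ctrmx M) = M.
Proof. by apply/matrixP => i j; rewrite !mxE conj_baseK. Qed.

Context {n : nat}.
Implicit Types (A : 'M[K]_n) (u v w : 'cV[K]_n).

Lemma dot_ge0 u : 0 <= dot u u.
Proof.
rewrite /dot mxE; apply: sumr_ge0 => i _.
by rewrite !mxE; exact: mul_conj_ge0.
Qed.

Lemma dot_mulmx A u v : dot u (A *m v) = dotA A u v.
Proof. by rewrite /dot /dotA mulmxA. Qed.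

Lemma dotA_conj A u v : ctrmx A = A -> dotA A v u = conj_base (dotA A u v).
Proof.
move=> hA; have -> : conj_base (dotA A u v) = ctrmx (ctrmx u *m A *m v) 0 0.
  by rewrite /dotA /ctrmx !mxE.
by rewrite !ctrmxM ctrmxK hA mulmxA.
Qed.

(** The real inner product underlying [dotA]. Step lengths are real, so A-norms along a search line
    involve only this part of the cross term. *)
Definition re_dotA A u v : R := re_part (dotA A u v).

Lemma re_dotAC A u v : ctrmx A = A -> re_dotA A u v = re_dotA A v u.
Proof. by move=> hA; rewrite /re_dotA (dotA_conj A v u hA) re_part_conj. Qed.

Lemma re_dotADr A u v w : re_dotA A u (v + w) = re_dotA A u v + re_dotA A u w.
Proof. by rewrite /re_dotA /dotA mulmxDr mxE raddfD. Qed.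

Lemma re_dotAZr A s u v : re_dotA A u (of_real k s *: v) = s * re_dotA A u v.
Proof. by rewrite /re_dotA /dotA -scalemxAr mxE re_partZ. Qed.

Lemma re_dotA_sqrD A u v s : ctrmx A = A ->
  re_dotA A (u + of_real k s *: v) (u + of_real k s *: v) =
  re_dotA A u u + 2 * s * re_dotA A u v + s ^+ 2 * re_dotA A v v.
Proof.
move=> hA; rewrite re_dotADr re_dotAZr.
rewrite ![re_dotA A (_ + _) _]re_dotAC // !re_dotADr !re_dotAZr.
rewrite (re_dotAC A v u hA); ring.
Qed.

Lemma norm2_sqr u : norm2 u ^+ 2 = re_part (dot u u).
Proof. by rewrite sqr_sqrtr // re_part_ge0 // dot_ge0. Qed.

Lemma normA_ge0 A u : 0 <= normA A u.
Proof. exact: sqrtr_ge0. Qed.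

(** * Geometry of the A-norm: Cauchy-Schwarz and exact line search *)

Context {A : 'M[K]_n} (posA : posdef A).

Let hermA : ctrmx A = A. Proof. by case: posA. Qed.

Lemma dotA_ge0 u : 0 <= dotA A u u.
Proof.
have [->|u0] := eqVneq u 0; first by rewrite /dotA mulmx0 mxE.
by apply: ltW; apply: (proj2 posA).
Qed.

Lemma normA_sqr u : normA A u ^+ 2 = re_dotA A u u.
Proof. by rewrite sqr_sqrtr // re_part_ge0 // dotA_ge0. Qed.

Lemma normA_gt0 u : u != 0 -> 0 < normA A u.
Proof. by move=> u0; rewrite sqrtr_gt0 re_part_gt0 //; apply: (proj2 posA). Qed.

(** A nonzero [u] with [A *m u = 0] would give [dotA A u u = 0]. As [kermx] is a left kernel, [u] is
    found as a transposed row of [kermx A^T]. *)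
Lemma posdef_unitmx : A \in unitmx.
Proof.
rewrite -unitmx_tr -row_free_unit -kermx_eq0; apply/eqP/row_matrixP => i.
rewrite row0; apply/eqP; apply: contraT => r0.
have : row i (kermx A^T) *m A^T = 0 by apply: sub_kermxP; exact: row_sub.
move/(congr1 trmx); rewrite trmx_mul trmxK trmx0 => Ar0.
have : (row i (kermx A^T))^T != 0.
  by apply: contra r0 => /eqP/(congr1 trmx); rewrite trmxK trmx0 => ->.
by move/(proj2 posA); rewrite -dot_mulmx Ar0 /dot mulmx0 mxE ltxx.
Qed.

Lemma normAZ s u : normA A (of_real k s *: u) = `|s| * normA A u.
Proof.
apply/eqP; rewrite -(@eqrXn2 _ 2) ?mulr_ge0 ?normA_ge0 //.
rewrite exprMn !normA_sqr real_normK ?num_real //.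
by rewrite re_dotAZr re_dotAC // re_dotAZr; apply/eqP; ring.
Qed.

Lemma re_dotA_le_normA u v : re_dotA A u v <= normA A u * normA A v.
Proof.
have [->|v0] := eqVneq v 0.
  by rewrite /re_dotA /dotA mulmx0 mxE raddf0 mulr_ge0 ?normA_ge0.
(* This [s] minimizes the squared A-norm of [u + s v]; nonnegativity of the minimum is the squared
   Cauchy-Schwarz inequality. *)
have b0 := normA_gt0 v v0; set s := - (re_dotA A u v / normA A v ^+ 2).
have : 0 <= re_dotA A (u + of_real k s *: v) (u + of_real k s *: v).
  by rewrite -normA_sqr sqr_ge0.
rewrite re_dotA_sqrD // -!normA_sqr {}/s => h.
apply: le_trans (ler_norm _) _.
rewrite -(@ler_pXn2r _ 2) ?nnegrE ?mulr_ge0 ?normA_ge0 //.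
rewrite real_normK ?num_real // exprMn -ler_pdivrMr ?exprn_gt0 //.
rewrite -subr_ge0; move: h; congr (0 <= _).
by field; rewrite gt_eqF.
Qed.

Lemma ler_normAD u v : normA A (u + v) <= normA A u + normA A v.
Proof.
rewrite -(@ler_pXn2r _ 2) ?nnegrE ?addr_ge0 ?normA_ge0 // normA_sqr.
have := re_dotA_sqrD A u v 1 hermA; rewrite rmorph1 scale1r => ->.
by rewrite sqrrD !normA_sqr; have := re_dotA_le_normA u v; lra.
Qed.

(** Pythagoras: the hypothesis makes [s v] the projection of [u] on the real line spanned by [v]. *)
Lemma normA_line_search_sqr u v s : re_dotA A u v = s * normA A v ^+ 2 ->
  normA A (u - of_real k s *: v) ^+ 2 =
  normA A u ^+ 2 - s ^+ 2 * normA A v ^+ 2.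
Proof.
move=> h; rewrite -scaleNr -rmorphN normA_sqr re_dotA_sqrD // h -!normA_sqr.
by ring.
Qed.

(** The squares of the two sides differ by [(r - s)^2] times the squared A-norm of [v]. *)
Lemma normA_line_search_le u v s r : re_dotA A u v = s * normA A v ^+ 2 ->
  normA A (u - of_real k s *: v) <= normA A (u - of_real k r *: v).
Proof.
move=> h; rewrite -(@ler_pXn2r _ 2) ?nnegrE ?normA_ge0 //.
rewrite normA_line_search_sqr // -scaleNr -rmorphN [leRHS]normA_sqr.
rewrite re_dotA_sqrD // h -!normA_sqr.
have := mulr_ge0 (sqr_ge0 (r - s)) (sqr_ge0 (normA A v)); nra.
Qed.

End Forms.

Theorem theorem1 (R : realType) (k : field_kind) (n : nat)
    (A : 'M[base_field R k]_n) (y t zt dz : 'cV[base_field R k]_n) (eps : R) :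
  let xs := invmx A *m y in
  let c := xs - t in
  let z := y - A *m t in
  let x := sd_step A t zt in
  let dt := xs - x in
  let omega_z := sd_progress A xs t in
  let omega_zt := omega_z + eps * Num.sqrt (2 * (1 - omega_z ^+ 2))
                  + 1 / (2 * Num.sqrt 2) * eps ^+ 3 * cond A ^+ 2 in
  posdef A ->
  c != 0 ->
  0 <= eps ->
  z = zt + dz ->
  dot zt dz = 0 ->
  normA A dz <= eps * normA A zt ->
  eps * normA A zt <= eps * normA A z ->
  of_real k (omega_z ^+ 2) =
    1 - dot z z / dot z (A *m z) * (dot z z / dot z (invmx A *m z))
  /\ normA A dt <= omega_zt * normA A c.
Proof.
move=> xs c z x dt omega_z omega_zt posA c0 eps0 zE zt_dz dz_le zt_le.
have [hermA _] := posA; have Aunit := posdef_unitmx posA.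
have Axs : A *m xs = y by rewrite /xs mulKVmx.
have zAc : z = A *m c by rewrite /c mulmxBr Axs.
have cAz : invmx A *m z = c by rewrite zAc mulKmx.
have z0 : z != 0 by apply: contra_neq c0 => z0; rewrite -cAz z0 mulmx0.
have z_gt0 := normA_gt0 posA z z0; have c_gt0 := normA_gt0 posA c c0.
(* Otherwise the bound on [dz] gives it A-norm 0, so [dz], and with it [z], vanishes. *)
have zt0 : zt != 0.
  apply: contra_neq z0 => zt0; rewrite zE zt0 add0r; apply/eqP.
  apply: contraT => /(normA_gt0 posA); apply: contraTT => _.
  rewrite -leNgt; apply: le_trans dz_le _; rewrite zt0.
  by rewrite /normA /dotA mulmx0 mxE raddf0 sqrtr0 mulr0.
have zt_gt0 := normA_gt0 posA zt zt0.
pose a := norm2 z ^+ 2 / normA A z ^+ 2.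
pose b := norm2 zt ^+ 2 / normA A zt ^+ 2.
have aE : a * normA A z ^+ 2 = norm2 z ^+ 2.
  by rewrite divfK ?expf_neq0 ?gt_eqF.
have bE : b * normA A zt ^+ 2 = norm2 zt ^+ 2.
  by rewrite divfK ?expf_neq0 ?gt_eqF.
have a0 : 0 <= a by rewrite divr_ge0 ?sqr_ge0.
have omegaE : omega_z * normA A c = normA A (c - of_real k a *: z).
  rewrite /omega_z /sd_progress /sd_step Axs -/z -/c divfK ?gt_eqF //.
  by rewrite opprD addrA.
have omega0 : 0 <= omega_z by rewrite divr_ge0 ?normA_ge0.
have dtE : dt = c - of_real k b *: zt.
  by rewrite /dt /x /sd_step -/b opprD addrA.
rewrite {}dtE {}/omega_zt {dt x}; clearbody a b omega_z.
(* As [A *m c = z], the A-product of [z] and [c] is [dot z z]: the unperturbed step is an exact line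
   search. *)
have line_z : re_dotA A c z = a * normA A z ^+ 2.
  by rewrite re_dotAC // /re_dotA -dot_mulmx -zAc -norm2_sqr.
(* Here orthogonality enters: [dot zt z] reduces to [dot zt zt], so the perturbed step is an exact
   line search too. *)
have line_zt : re_dotA A c zt = b * normA A zt ^+ 2.
  rewrite re_dotAC // /re_dotA -dot_mulmx -zAc zE /dot mulmxDr mxE.
  by rewrite -/(dot zt zt) -/(dot zt dz) zt_dz addr0 -norm2_sqr.
have omega_sqr : (1 - omega_z ^+ 2) * normA A c ^+ 2 = (a * normA A z) ^+ 2.
  have := normA_line_search_sqr posA c z a line_z.
  by rewrite -omegaE !exprMn mulrBl mul1r => ->; rewrite subKr.
split.
  (* Every product in the formula is the image of a real number, which reduces the identity over the
     scalar field to one in [R]. *)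
  have dotAE u : dotA A u u = of_real k (normA A u ^+ 2).
    by rewrite normA_sqr // of_real_re_part ?dotA_ge0.
  have dotzE : dot z z = of_real k (a * normA A z ^+ 2).
    by rewrite aE norm2_sqr of_real_re_part ?dot_ge0.
  have dot_inv : dot z (invmx A *m z) = dotA A c c.
    by rewrite cAz zAc /dot /dotA ctrmxM hermA.
  rewrite dot_inv dot_mulmx !dotAE dotzE -!fmorph_div -rmorphM.
  rewrite -(rmorph1 (of_real k)) -rmorphB; congr of_real.
  have -> : omega_z ^+ 2 = 1 - (a * normA A z) ^+ 2 / normA A c ^+ 2.
    by rewrite -omega_sqr mulfK ?subKr // expf_neq0 ?gt_eqF.
  by field; rewrite !gt_eqF.
have sqrtE : Num.sqrt (1 - omega_z ^+ 2) * normA A c = a * normA A z.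
  (* Needed because [Num.sqrt] is 0 on negative numbers. *)
  have w1 : 0 <= 1 - omega_z ^+ 2.
    by rewrite -(pmulr_lge0 _ (exprn_gt0 2 c_gt0)) omega_sqr sqr_ge0.
  apply/eqP; rewrite -(@eqrXn2 _ 2) ?mulr_ge0 ?sqrtr_ge0 ?normA_ge0 //.
  by rewrite exprMn sqr_sqrtr // omega_sqr.
(* Replacing the optimal [b] by [a] can only enlarge the error. *)
apply: le_trans (normA_line_search_le posA c zt b a line_zt) _.
have -> : c - of_real k a *: zt = (c - of_real k a *: z) + of_real k a *: dz.
  by rewrite zE scalerDr opprD addrA addrNK.
apply: le_trans (ler_normAD posA _ _) _.
rewrite -omegaE normAZ // ger0_norm //.
rewrite 2![(_ + _) * normA A c]mulrDl -addrA lerD2l.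
(* The [dz] contribution is matched with the [eps] term, using [1 <= sqrt 2]; the cubic term only
   has to be nonnegative. *)
rewrite -[leLHS]addr0 lerD //.
  apply: le_trans (ler_wpM2l a0 (le_trans dz_le zt_le)) _.
  rewrite mulrCA -sqrtE mulrA ler_wpM2r ?normA_ge0 // ler_wpM2l //.
  by rewrite sqrtrM // ler_peMl ?sqrtr_ge0 // -[leLHS]sqrtr1 ler_sqrt // ler1n.
rewrite mulr_ge0 ?normA_ge0 // mulr_ge0 ?sqr_ge0 // mulr_ge0 ?exprn_ge0 //.
by rewrite divr_ge0 ?mulr_ge0 ?sqrtr_ge0.
Qed.
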